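(* Let $n,p\in\mathbb{N}$ and let $m$ be an even positive integer. Let $f_l$, $l=0,1,\ldots,p$, be real polynomials on $\mathbb{R}^n$ with essentially nonpositive coefficients and degree $m$. Consider the nonconvex polynomial optimization problem $$(P)\qquad \min_{x\in\mathbb{R}^n}\{f_0(x): f_l(x)\le 0,\ l=1,\ldots,p\}.$$ Suppose that the strict feasibility condition holds, i.e., there exists $x_0\in\mathbb{R}^n$ such that $f_l(x_0)<0$ for all $l=1,\ldots,p$. Then $$\min(P)=\max\Big\{\mu:\ f_0+\sum_{l=1}^p\lambda_l f_l-\mu=\sigma_0,\ \lambda_l\ge 0,\ l=1,\ldots,p,\ \sigma_0\text{ is SOS},\ \deg\sigma_0\le m\Big\},$$ where the maximum is over $\mu\in\mathbb{R}$, $\lambda_1,\ldots,\lambda_p\in\mathbb{R}$ and real polynomials $\sigma_0$ on $\mathbb{R}^n$; and the maximum in the sum-of-squares problem is attained.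
   Context: $\mathbb{N}=\{1,2,\ldots\}$. $\min(P)$ denotes the optimal value of problem $(P)$. Polynomials with essentially nonpositive coefficients: let $f=\sum_{\alpha}f_\alpha x^\alpha$ be a real polynomial on $\mathbb{R}^n$ of degree $m$, where $x^\alpha=x_1^{\alpha_1}\cdots x_n^{\alpha_n}$. Put $\Omega_f=\{\alpha\in(\mathbb{N}\cup\{0\})^n: f_\alpha\ne 0,\ \alpha\ne m e_i,\ i=1,\ldots,n\}$, where $e_i$ is the $i$th standard unit vector. $f$ has essentially nonpositive coefficients if $f_\alpha\le 0$ for all $\alpha\in\Omega_f\setminus\{0\}$ (so the coefficients of $x_1^m,\ldots,x_n^m$ and the constant term are arbitrary). A real polynomial is SOS (a sum of squares) if it equals $\sum_{j=1}^r g_j^2$ for some $r\in\mathbb{N}$ and real polynomials $g_1,\ldots,g_r$.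
   Formalization: Attainment of the maximum is asserted only when min(P) is not minus infinity; if (P) is unbounded below (e.g. f_0=-x^2, f_1=-x^2-1), the sum-of-squares problem is infeasible and the equality is read as both sides being minus infinity. *)

(* Defs.v *)
From HB Require Import structures.
From mathcomp Require Import all_boot all_order all_algebra.
(* mpoly must be imported before constructive_ereal/ereal: in the other order
   the associativities of their level-2 notations clash. *)
From mathcomp Require Import mpoly.
From mathcomp Require Import classical_sets reals constructive_ereal ereal.

Set Implicit Arguments.
Unset Strict Implicit.
Unset Printing Implicit Defensive.

Local Open Scope ring_scope.
Local Open Scope classical_set_scope.

(* The total degree; deg 0 = 0 by truncation. *)
Definition deg (R : realType) (n : nat) (f : {mpoly R[n]}) : nat :=
  (msize f).-1.

Definition Omega (R : realType) (n : nat) (f : {mpoly R[n]}) :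
    set 'X_{1..n} :=
  [set a | f@_a != 0 /\ forall i : 'I_n, a != (U_(i) *+ deg f)%MM].

Definition ess_nonpos (R : realType) (n : nat) (f : {mpoly R[n]}) : Prop :=
  forall a : 'X_{1..n}, (Omega f `\ 0%MM) a -> f@_a <= 0.

Definition SOS (R : realType) (n : nat) (f : {mpoly R[n]}) : Prop :=
  exists (r : nat) (g : 'I_r -> {mpoly R[n]}),
    (0 < r)%N /\ f = \sum_(j < r) g j ^+ 2.

Section Problems.
Variables (R : realType) (n p m : nat).
(* f ord0 is the objective f_0, and f (lift ord0 l) is the constraint f_(l+1),
   for l : 'I_p. *)
Variable f : 'I_p.+1 -> {mpoly R[n]}.

Definition feasible : set ('I_n -> R) :=
  [set x | forall l : 'I_p, (f (lift ord0 l)).@[x] <= 0].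

Definition strictly_feasible : Prop :=
  exists x0 : 'I_n -> R, forall l : 'I_p, (f (lift ord0 l)).@[x0] < 0.

(* The optimal value of the minimization problem, as an extended real: it need
   be neither finite nor attained. *)
Definition minP : \bar R :=
  ereal_inf [set ((f ord0).@[x])%:E | x in feasible].

Definition sos_feasible : set R :=
  [set mu | exists (lambda : 'I_p -> R) (sigma0 : {mpoly R[n]}),
    [/\ f ord0 + \sum_(l < p) lambda l *: f (lift ord0 l) - mu%:MP = sigma0,
        forall l, 0 <= lambda l,
        SOS sigma0 &
        (deg sigma0 <= m)%N]].

End Problems.

(* Main.v *)
(* Substituting t_i = x_i^m turns a polynomial with essentially nonpositive
   coefficients into a convex function of t >= 0: the only nonlinear terms are
   -t^(a/m) with |a| <= m, and weighted geometric means are concave. Hence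
   Slater's condition yields Lagrange multipliers for which the Lagrangian,
   minus mu, is nonnegative, and this polynomial h again has essentially
   nonpositive coefficients.

   To see that h is SOS, homogenise it as
   sum_j d_j y_j^m - sum_a b_a y^a with b_a >= 0, give every monomial y^a its
   own copy of the variables, constrained to lie below y, and apply Lagrange
   duality once more on the positive orthant. Independence of the copies makes
   the resulting Lagrangian split into nonnegative pieces
   sum_j l_(a,j) y_j^m - b_a y^a plus a nonnegative diagonal. Each piece is,
   after rescaling the variables, a nonnegative combination of even powers and
   of Hurwitz's form sum_j e_j y_j^m - m y^e, which is SOS. *)
Require Import Defs.
From HB Require Import structures.
From mathcomp Require Import all_boot all_order all_algebra.
From mathcomp Require Import mpoly.
From mathcomp Require Import classical_sets reals constructive_ereal ereal.
From mathcomp Require Import ring lra.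

Set Implicit Arguments.
Unset Strict Implicit.
Unset Printing Implicit Defensive.

Import Order.TTheory GRing.Theory Num.Theory.

Local Open Scope ring_scope.
Local Open Scope classical_set_scope.

(** * Hurwitz's form is a sum of squares *)

(** One factor [b] is peeled off the two-variable form; the remainder is handled by [SOS_subX_mul].
    This drives the induction in [SOS_AGM2]. *)
Lemma AGM2_rec (A : comPzRingType) (a b : A) (k : nat) :
  a ^+ k.+2 + b ^+ k.+2 *+ k.+1 - (a * b ^+ k.+1) *+ k.+2 =
  b * (a ^+ k.+1 + b ^+ k.+1 *+ k - (a * b ^+ k) *+ k.+1) +
  (a - b) * (a ^+ k.+1 - b ^+ k.+1).
Proof. by rewrite !exprS; ring. Qed.

Lemma sum_AGM2 (A : comPzRingType) (s : seq A) (x a : A) (F G : A -> A)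
    (i j : nat) :
  \sum_(b <- s) (x + F b *+ i - (a * G b) *+ j) =
  x *+ size s + (\sum_(b <- s) F b) *+ i - (a * \sum_(b <- s) G b) *+ j.
Proof.
elim: s => [|b s IH]; first by rewrite !big_nil /=; ring.
by rewrite !big_cons IH /= mulrS; ring.
Qed.

Lemma AGM_cons (A : comPzRingType) (x a S P : A) (i j : nat) :
  (x - (a * P) *+ i) *+ j = x *+ j - (a * S) *+ i + a * (S - P *+ j) *+ i.
Proof. by ring. Qed.

Lemma AGM_halves (A : comPzRingType) (S T P Q : A) (k : nat) :
  S + T - (P * Q) *+ k.*2 = (S - P ^+ 2 *+ k) + (T - Q ^+ 2 *+ k) +
  (P - Q) ^+ 2 *+ k.
Proof. by rewrite -mul2n; ring. Qed.

Section SOSCone.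
Variables (R : realType) (n : nat).
Implicit Types (f g a b : {mpoly R[n]}) (s : seq {mpoly R[n]}).

Lemma SOS_seqP f : SOS f <-> exists s, f = \sum_(g <- s) g ^+ 2.
Proof.
split=> [[r [g [_ ->]]]|[s ->]].
  by exists [seq g j | j : 'I_r]; rewrite big_image.
exists (size (0 :: s)), (fun j => (0 :: s)`_j); split=> //.
by rewrite big_ord_recl /= expr0n add0r (big_nth 0) big_mkord.
Qed.

Lemma SOS_sqr f : SOS (f ^+ 2).
Proof. by apply/SOS_seqP; exists [:: f]; rewrite big_seq1. Qed.

Lemma SOS0 : SOS (0 : {mpoly R[n]}).
Proof. by apply/SOS_seqP; exists [::]; rewrite big_nil. Qed.

Lemma SOSD f g : SOS f -> SOS g -> SOS (f + g).
Proof.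
move=> /SOS_seqP[s ->] /SOS_seqP[t ->]; apply/SOS_seqP.
by exists (s ++ t); rewrite big_cat.
Qed.

Lemma SOS_sum (I : Type) (r : seq I) (P : pred I) (F : I -> {mpoly R[n]}) :
  (forall i, P i -> SOS (F i)) -> SOS (\sum_(i <- r | P i) F i).
Proof. by move=> SF; apply: big_ind => //; [exact: SOS0 | exact: SOSD]. Qed.

Lemma SOSM f g : SOS f -> SOS g -> SOS (f * g).
Proof.
move=> /SOS_seqP[s ->] /SOS_seqP[t ->]; rewrite mulr_suml.
apply: SOS_sum => a _; rewrite mulr_sumr; apply: SOS_sum => b _.
by rewrite -exprMn; exact: SOS_sqr.
Qed.

Lemma SOSC (c : R) : 0 <= c -> SOS (c%:MP : {mpoly R[n]}).
Proof. by move=> c0; rewrite -(sqr_sqrtr c0) rmorphXn; exact: SOS_sqr. Qed.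

Lemma SOSZ (c : R) f : 0 <= c -> SOS f -> SOS (c *: f).
Proof. by move=> c0 Sf; rewrite -mul_mpolyC; apply: SOSM => //; exact: SOSC. Qed.

Lemma SOS_even_exp (k : nat) f : ~~ odd k -> SOS (f ^+ k).
Proof. by move=> /even_halfK <-; rewrite -mul2n mulnC exprM; exact: SOS_sqr. Qed.

Lemma SOSX (k : nat) f : SOS f -> SOS (f ^+ k).
Proof.
move=> Sf; elim: k => [|k IH]; last by rewrite exprS; exact: SOSM.
by rewrite expr0 -[1](expr1n _ 2); exact: SOS_sqr.
Qed.

Lemma SOS_meval_ge0 f x : SOS f -> 0 <= f.@[x].
Proof.
move=> /SOS_seqP[s ->]; rewrite rmorph_sum sumr_ge0// => g _.
by rewrite rmorphXn sqr_ge0.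
Qed.

(** Factoring [a ^+ k - b ^+ k] supplies a second [a - b], so a square appears, times a sum of
    products of powers of [a] and [b]. *)
Lemma SOS_subX_mul (k : nat) a b :
  SOS a -> SOS b -> SOS ((a - b) * (a ^+ k - b ^+ k)).
Proof.
move=> Sa Sb; rewrite subrXX mulrA -expr2; apply: SOSM; first exact: SOS_sqr.
by apply: SOS_sum => i _; apply: SOSM; exact: SOSX.
Qed.

Lemma SOS_AGM2 (k : nat) a b : SOS a -> SOS b ->
  SOS (a ^+ k.+1 + b ^+ k.+1 *+ k - (a * b ^+ k) *+ k.+1).
Proof.
move=> Sa Sb; elim: k => [|k IH].
  by rewrite mulr0n addr0 expr0 mulr1 expr1 mulr1n subrr; exact: SOS0.
by rewrite AGM2_rec; apply: SOSD; [exact: SOSM | exact: SOS_subX_mul].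
Qed.

(* Induction on [s]: multiply the inequality for [s] by [a] and bound each
   [a * b ^+ k] by [SOS_AGM2]. *)
Lemma SOS_AGM_seq s : {in s, forall a, SOS a} ->
  SOS (\sum_(a <- s) a ^+ size s - (\prod_(a <- s) a) *+ size s).
Proof.
elim: s => [|a s IH] Ss.
  by rewrite !big_nil mulr0n subr0; exact: SOS0.
have Sa : SOS a by apply: Ss; rewrite mem_head.
have {}Ss : {in s, forall b, SOS b} by move=> b bs; apply: Ss; rewrite inE bs orbT.
have {}IH := IH Ss; rewrite !big_cons /=.
case E : (size s) IH => [|k] IH.
  by rewrite (size0nil E) !big_nil addr0 mulr1 subrr; exact: SOS0.
set P := \prod_(b <- s) b in IH *.
set S1 := \sum_(b <- s) b ^+ k.+1 in IH *.
set S2 := \sum_(b <- s) b ^+ k.+2.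
have S12 : SOS (\sum_(b <- s)
    (a ^+ k.+2 + b ^+ k.+2 *+ k.+1 - (a * b ^+ k.+1) *+ k.+2)).
  by rewrite big_seq; apply: SOS_sum => b bs; apply: SOS_AGM2 => //; exact: Ss.
have sumE : \sum_(b <- s)
    (a ^+ k.+2 + b ^+ k.+2 *+ k.+1 - (a * b ^+ k.+1) *+ k.+2) =
    (a ^+ k.+2 + S2) *+ k.+1 - (a * S1) *+ k.+2.
  by rewrite (sum_AGM2 _ _ _ (fun b => b ^+ k.+2)) E mulrnDl.
have k0 : 0 <= k.+1%:R^-1 :> R by rewrite invr_ge0.
(* Summing over the [k.+1] elements of [s] produces the form [k.+1] times, so this factor is
   inserted and divided off. *)
have -> : a ^+ k.+2 + S2 - (a * P) *+ k.+2 =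
    k.+1%:R^-1 *: ((a ^+ k.+2 + S2 - (a * P) *+ k.+2) *+ k.+1).
  by rewrite -(scaler_nat k.+1) scalerA mulVf ?scale1r// pnatr_eq0.
apply: SOSZ => //; rewrite (AGM_cons _ _ S1) -sumE; apply: SOSD => //.
by rewrite -(scaler_nat k.+2); apply: SOSZ => //; exact: SOSM.
Qed.

(* The product is split into two halves of equal size, with product [P] and
   [Q]; [P * Q] is bounded by the mean of [P ^+ 2] and [Q ^+ 2], and
   [SOS_AGM_seq] applies to the squares. *)
Lemma SOS_hurwitz_seq (k : nat) s : size s = k.*2 ->
  SOS (\sum_(a <- s) a ^+ k.*2 - (\prod_(a <- s) a) *+ k.*2).
Proof.
have half (t : seq {mpoly R[n]}) : size t = k ->
    SOS (\sum_(a <- t) a ^+ k.*2 - (\prod_(a <- t) a) ^+ 2 *+ k).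
  move=> tk; have /SOS_AGM_seq : {in [seq a ^+ 2 | a <- t], forall a, SOS a}.
    by move=> _ /mapP[a _ ->]; exact: SOS_sqr.
  rewrite size_map tk !big_map prodrXl.
  by under eq_bigr do rewrite -exprM mul2n.
move=> sk; rewrite -(cat_take_drop k s) !big_cat /= AGM_halves.
apply: SOSD; last by rewrite -scaler_nat; apply: SOSZ => //; exact: SOS_sqr.
apply: SOSD; apply: half; rewrite ?size_drop ?size_take sk -addnn ?addnK//.
case: ltnP => //; case: (k) => // j.
by rewrite -[X in (_ <= X)%N -> _]addn0 leq_add2l.
Qed.

(** Reduces to [SOS_hurwitz_seq] for the list repeating each [y j] exactly [e j] times. *)
Lemma SOS_hurwitz (J : finType) (e : J -> nat) (m : nat)
    (y : J -> {mpoly R[n]}) : (\sum_j e j)%N = m -> ~~ odd m ->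
  SOS (\sum_j (e j)%:R *: y j ^+ m - m%:R *: \prod_j y j ^+ e j).
Proof.
move=> em /even_halfK mk.
pose s := flatten [seq nseq (e j) (y j) | j : J].
have sz : size s = m./2.*2.
  rewrite mk -em size_flatten /shape -map_comp sumnE big_map big_enum /=.
  by apply: eq_bigr => j _; rewrite size_nseq.
have /SOS_hurwitz_seq := sz; rewrite mk /s !big_flatten !big_image /=.
rewrite -(scaler_nat m).
under [X in SOS (X - _)]eq_bigr do
  rewrite big_nseq iter_addr_0 -scaler_nat.
by under [X in _ *: X]eq_bigr do rewrite big_nseq iter_mulr_1.
Qed.

End SOSCone.

(** * Hoelder's inequality *)

Lemma exists_root (R : rcfType) (m : nat) (a : R) : (0 < m)%N -> 0 <= a ->
  exists2 z, 0 <= z & z ^+ m = a.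
Proof.
(* The right end works because [(1 + a) ^+ m >= 1 + a >= a]. *)
move=> m0 a0; have [||z /andP[z0 _] /rootP] := @poly_ivt R ('X^m - a%:P) 0 (1 + a).
- by rewrite addr_ge0.
- rewrite !hornerE expr0n gtn_eqF// sub0r oppr_le0 a0 subr_ge0.
  by apply: le_trans (ler_eXnr m0 _); rewrite ?lerDr ?lerDl.
by rewrite !hornerE => /eqP; rewrite subr_eq0 => /eqP; exists z.
Qed.

Lemma exists_root_gt0 (R : rcfType) (m : nat) (a : R) : (0 < m)%N -> 0 < a ->
  exists2 z, 0 < z & z ^+ m = a.
Proof.
move=> m0 a0; have [z z0 za] := exists_root m0 (ltW a0); exists z => //.
rewrite lt_def z0 andbT; apply: contraTneq a0 => zz.
by rewrite -za zz expr0n gtn_eqF// ltxx.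
Qed.

Section RealAGM.
Variables (R : realType) (J : finType) (e : J -> nat) (m : nat).
Hypotheses (em : (\sum_j e j)%N = m) (m_gt0 : (0 < m)%N) (m_even : ~~ odd m).

Lemma real_AGM (u : J -> R) :
  m%:R * \prod_j u j ^+ e j <= \sum_j (e j)%:R * u j ^+ m.
Proof.
have /(SOS_meval_ge0 (fun=> 0)) :=
  SOS_hurwitz (n := 0) (fun j => (u j)%:MP) em m_even.
rewrite mevalB linearZ /= rmorph_sum rmorph_prod subr_ge0.
under [X in _ * X <= _]eq_bigr do rewrite rmorphXn /= mevalC.
by under [X in _ <= X]eq_bigr do rewrite /= linearZ rmorphXn /= mevalC.
Qed.

(* I.e. [\prod_j t_j ^ (e j / m)] is concave in [t_j = x_j ^+ m]. *)
Lemma prod_exp_concave (x y z : J -> R) (a b : R) : 0 <= a -> 0 <= b ->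
    (forall j, 0 <= z j) ->
    (forall j, z j ^+ m = a * x j ^+ m + b * y j ^+ m) ->
  a * \prod_j x j ^+ e j + b * \prod_j y j ^+ e j <= \prod_j z j ^+ e j.
Proof.
move=> a0 b0 z0 zE.
have Xm_ge0 (t : R) : 0 <= t ^+ m by rewrite exprn_even_ge0.
(* If [z j = 0] for some [e j > 0], both weighted products on the left vanish. *)
have [/existsP[j /andP[ej /eqP zj]]|/existsPn zpos] :=
    boolP [exists j, (0 < e j)%N && (z j == 0)].
  have vanish (c : R) (t : J -> R) : 0 <= c -> c * t j ^+ m <= 0 ->
      c * \prod_j t j ^+ e j = 0.
    move=> c0 ct; have /eqP : c * t j ^+ m = 0.
      by apply/eqP; rewrite eq_le ct mulr_ge0.
    rewrite mulf_eq0 => /orP[/eqP->|]; first by rewrite mul0r.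
    rewrite expf_eq0 => /andP[_ /eqP tj].
    by rewrite (bigD1 j)//= tj expr0n gtn_eqF// mul0r mulr0.
  have := zE j; rewrite zj expr0n gtn_eqF//= => /esym zE0.
  have ax : 0 <= a * x j ^+ m by rewrite mulr_ge0.
  have bx : 0 <= b * y j ^+ m by rewrite mulr_ge0.
  rewrite (vanish a x) ?(vanish b y)//; [|lra|lra].
  by rewrite addr0 prodr_ge0// => i _; rewrite exprn_ge0.
have zn0 j : (0 < e j)%N -> z j != 0.
  by move=> ej; have := zpos j; rewrite ej.
(* Dividing by [z] normalises the right-hand side to [1]; where [e j = 0], [z j] may vanish, but the
   factor is [1] anyway. *)
have rescale (t : J -> R) :
    \prod_j t j ^+ e j = (\prod_j (t j / z j) ^+ e j) * \prod_j z j ^+ e j.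
  rewrite -big_split /=; apply: eq_bigr => j _.
  case: (posnP (e j)) => [->|ej]; first by rewrite !expr0 mulr1.
  by rewrite -exprMn divfK// zn0.
rewrite (rescale x) (rescale y) !mulrA -mulrDl.
rewrite -[leRHS]mul1r ler_wpM2r ?prodr_ge0// => [i _|]; first by rewrite exprn_ge0.
have mR : 0 < m%:R :> R by rewrite ltr0n.
rewrite -(ler_pM2l mR) mulr1 mulrDr !(mulrCA m%:R).
have mE : m%:R = a * (\sum_j (e j)%:R * (x j / z j) ^+ m) +
                 b * (\sum_j (e j)%:R * (y j / z j) ^+ m).
  rewrite !mulr_sumr -big_split /= -[in LHS]em natr_sum; apply: eq_bigr => j _.
  case: (posnP (e j)) => [->|ej]; first by rewrite !mul0r !mulr0 addr0.
  rewrite !expr_div_n !mulrA !(mulrAC _ (e j)%:R) -!mulrDl -zE.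
  by rewrite divff ?mul1r// expf_neq0// zn0.
rewrite [leRHS]mE; apply: lerD; apply: ler_wpM2l => //.
  exact: (real_AGM (fun j => x j / z j)).
exact: (real_AGM (fun j => y j / z j)).
Qed.

End RealAGM.

(** * Lagrange duality for convexlike problems *)

Section Lagrange.
Variable R : realType.

(* The multiplier is the supremum of [- f x / g x] over [g x > 0]; convexity on
   the segment from [x] to [y] with [g y < 0] bounds it by [f y / - g y]. *)
Lemma slater_duality1 (T : Type) (f g : T -> R) (C : T -> Prop) (x0 : T) :
    (forall x y a b, C x -> C y -> 0 <= a -> 0 <= b -> a + b = 1 ->
      exists z, [/\ C z, f z <= a * f x + b * f y & g z <= a * g x + b * g y]) ->
    C x0 -> g x0 < 0 -> (forall x, C x -> g x <= 0 -> 0 <= f x) ->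
  exists2 nu, 0 <= nu & forall x, C x -> 0 <= f x + nu * g x.
Proof.
move=> mix Cx0 gx0 fge0.
have cross x y : C x -> C y -> g y < 0 -> 0 < g x -> - f x / g x <= f y / - g y.
  move=> Cx Cy gy gx; have gy' : 0 < - g y by rewrite oppr_gt0.
  have s0 : 0 < g x - g y by rewrite subr_gt0 (lt_trans gy).
  (* These weights make the combination of [g x] and [g y] vanish. *)
  have [|||z [Cz fz gz]] :=
      mix x y (- g y / (g x - g y)) (g x / (g x - g y)) Cx Cy.
  - by rewrite divr_ge0// ltW.
  - by rewrite divr_ge0// ltW.
  - by rewrite -mulrDl addrC divff// gt_eqF.
  have {gz}: g z <= 0.
    apply: le_trans gz _; rewrite -!mulrA ![_^-1 * _]mulrC !mulrA -mulrDl.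
    by rewrite mulNr [g y * _]mulrC addNr mul0r.
  move=> /(fge0 _ Cz) /le_trans /(_ fz).
  rewrite -!mulrA ![_^-1 * _]mulrC !mulrA -mulrDl pmulr_lge0 ?invr_gt0// => h.
  by rewrite ler_pdivrMr// mulrAC ler_pdivlMr//; lra.
(* Including [0] makes [A] nonempty and [sup A] nonnegative. *)
pose A : set R := [set r | r = 0 \/ exists x, [/\ C x, 0 < g x & r = - f x / g x]].
have ubA y : C y -> g y < 0 -> ubound A (f y / - g y).
  move=> Cy gy _ [->|[x [Cx gx ->]]]; last exact: cross.
  by rewrite divr_ge0 ?oppr_ge0 ?(ltW gy)// fge0// ltW.
have A0 : A 0 by left.
have supA : has_sup A by split; [exists 0 | exists (f x0 / - g x0); exact: ubA].
exists (sup A) => [|x Cx]; first exact: sup_upper_bound supA _ A0.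
case: (ltgtP (g x) 0) => gx.
- have : sup A <= f x / - g x by apply: ge_sup; [exists 0 | exact: ubA].
  by rewrite ler_pdivlMr ?oppr_gt0// mulrN; lra.
- have : - f x / g x <= sup A.
    by apply: (sup_upper_bound supA); right; exists x.
  by rewrite ler_pdivrMr//; lra.
- by rewrite gx mulr0 addr0 fge0// gx.
Qed.

(* Strong duality under Slater's condition; the constraints are dualised one
   at a time, the remaining ones being absorbed in the domain [C]. *)
Lemma slater_duality (T : Type) (I : eqType) (s : seq I) (f : T -> R)
    (g : I -> T -> R) (C : T -> Prop) (x0 : T) : uniq s ->
    (forall x y a b, C x -> C y -> 0 <= a -> 0 <= b -> a + b = 1 ->
      exists z, [/\ C z, f z <= a * f x + b * f y &
        forall i, g i z <= a * g i x + b * g i y]) ->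
    C x0 -> (forall i, g i x0 < 0) ->
    (forall x, C x -> (forall i, i \in s -> g i x <= 0) -> 0 <= f x) ->
  exists2 la : I -> R, (forall i, 0 <= la i) &
    forall x, C x -> 0 <= f x + \sum_(i <- s) la i * g i x.
Proof.
move=> + + + gx0; elim: s f C => [|i s IH] f C us mix Cx0 fge0.
  by exists (fun=> 0) => // x Cx; rewrite big_nil addr0; exact: fge0.
have /andP[is_ us'] := us.
pose C' x := C x /\ forall j, j \in s -> g j x <= 0.
have [||||nu nu0 fnu] := @slater_duality1 T f (g i) C' x0.
- move=> x y a b [Cx gx] [Cy gy] a0 b0 ab.
  have [z [Cz fz gz]] := mix x y a b Cx Cy a0 b0 ab.
  exists z; split=> //; split=> // j js; apply: le_trans (gz j) _.
  by rewrite -[leRHS](addr0 0) lerD// mulr_ge0_le0 ?gx ?gy.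
- by split=> // j _; exact/ltW/gx0.
- exact: gx0.
- move=> x [Cx gx] gix; apply: fge0 => // j; rewrite inE => /predU1P[->//|].
  exact: gx.
have [||la la0 fla] := IH (fun x => f x + nu * g i x) C us' _ Cx0.
- move=> x y a b Cx Cy a0 b0 ab.
  have [z [Cz fz gz]] := mix x y a b Cx Cy a0 b0 ab.
  exists z; split=> //; have := ler_wpM2l nu0 (gz i); lra.
- by move=> x Cx gx; exact: fnu.
(* Since [i] is not in [s], the multipliers of [s] are unaffected. *)
exists (fun j => if j == i then nu else la j) => [j|x Cx]; first by case: eqP.
rewrite big_cons eqxx addrA; have := fla x Cx.
rewrite (eq_big_seq (fun j => (if j == i then nu else la j) * g j x))// => j js.
by case: eqP is_ => // <-; rewrite js.
Qed.

End Lagrange.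

Lemma affine_ge0_slope (R : realFieldType) (u v : R) :
  (forall s, 0 < s -> 0 <= s * u + v) -> 0 <= u.
Proof.
move=> h; rewrite leNgt; apply/negP => u0.
(* For this value of [s], [s * u + v <= -1]. *)
have := h ((`|v| + 1) / - u); rewrite divr_gt0 ?oppr_gt0 ?ltr_pwDr//.
rewrite invrN mulrN mulNr divfK ?lt_eqF// => /(_ isT).
by have := ler_norm v; lra.
Qed.

(** * Power means *)

Section Mean.
Variables (R : realType) (J : finType) (m : nat).
Hypotheses (m_gt0 : (0 < m)%N) (m_even : ~~ odd m).

(** A combination in the coordinates [t_j = x_j ^+ m], pulled back by nonnegative roots. *)
Lemma power_mean_exists (x y : J -> R) (a b : R) : 0 <= a -> 0 <= b ->
  exists z : J -> R, forall j, 0 <= z j /\ z j ^+ m = a * x j ^+ m + b * y j ^+ m.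
Proof.
move=> a0 b0; apply: (fin_all_exists (P := fun j z =>
  0 <= z /\ z ^+ m = a * x j ^+ m + b * y j ^+ m)) => j.
have [|z z0 zE] := @exists_root R m (a * x j ^+ m + b * y j ^+ m) m_gt0.
  by rewrite addr_ge0// mulr_ge0// exprn_even_ge0.
by exists z.
Qed.

Lemma power_mean_gt0 (x y z a b : R) : 0 <= a -> 0 <= b -> a + b = 1 ->
  0 < x -> 0 < y -> 0 <= z -> z ^+ m = a * x ^+ m + b * y ^+ m -> 0 < z.
Proof.
move=> a0 b0 ab x0 y0 z0 zE; rewrite lt_def z0 andbT; apply/eqP => zz.
have xm : 0 < x ^+ m by rewrite exprn_gt0.
have ym : 0 < y ^+ m by rewrite exprn_gt0.
move: zE; rewrite zz expr0n gtn_eqF//= => h.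
have ax := mulr_ge0 a0 (ltW xm); have by_ := mulr_ge0 b0 (ltW ym).
have /eqP : a * x ^+ m = 0 by lra.
have /eqP : b * y ^+ m = 0 by lra.
rewrite !mulf_eq0 !(gt_eqF xm) !(gt_eqF ym) !orbF => /eqP ? /eqP ?; lra.
Qed.

End Mean.

(** * Splitting a nonnegative form into binomials *)

Section Split.
Variables (R : realType) (J A : finType) (m : nat) (e : A -> J -> nat).
Variables (d : J -> R) (b : A -> R).
Hypotheses (m_gt0 : (0 < m)%N) (m_even : ~~ odd m).
Hypotheses (eE : forall a, (\sum_j e a j)%N = m) (b_ge0 : forall a, 0 <= b a).

(* [x] and [y a] are the original variables and the copy used by the monomial
   [a]; the dualised constraints are [y a j ^+ m <= x j ^+ m]. *)
Lemma nonneg_lagrange :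
    (forall x : J -> R, (forall j, 0 < x j) ->
       0 <= \sum_j d j * x j ^+ m - \sum_a b a * \prod_j x j ^+ e a j) ->
  exists2 la : A -> J -> R, (forall a j, 0 <= la a j) &
    forall (x : J -> R) (y : A -> J -> R),
      (forall j, 0 < x j) -> (forall a j, 0 < y a j) ->
      0 <= \sum_j (d j - \sum_a la a j) * x j ^+ m +
           \sum_a (\sum_j la a j * y a j ^+ m - b a * \prod_j y a j ^+ e a j).
Proof.
move=> F0.
pose C (t : (J -> R) * (A -> J -> R)) :=
  (forall j, 0 < t.1 j) /\ (forall a j, 0 < t.2 a j).
pose f (t : (J -> R) * (A -> J -> R)) :=
  \sum_j d j * t.1 j ^+ m - \sum_a b a * \prod_j t.2 a j ^+ e a j.
pose g (i : A * J) (t : (J -> R) * (A -> J -> R)) :=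
  t.2 i.1 i.2 ^+ m - t.1 i.2 ^+ m.
(* The Slater point has [x = 2] and all copies equal to [1]; it is strict because [2 ^+ m > 1]. *)
have [||||la la0 fla] := @slater_duality R _ _ (index_enum (A * J)%type) f g C
  (fun=> 2, fun _ _ => 1) (index_enum_uniq _).
- move=> [x y] [x' y'] r s [/= x0 y0] [/= x'0 y'0] r0 s0 rs.
  have [z zP] := power_mean_exists m_gt0 m_even x x' r0 s0.
  have /fin_all_exists[w wP] a := power_mean_exists m_gt0 m_even (y a) (y' a) r0 s0.
  exists (z, w); split.
  + split=> [j|a j] /=.
      by have [? ?] := zP j; apply: (power_mean_gt0 m_gt0 r0 s0 rs (x0 j) (x'0 j)).
    by have [? ?] := wP a j; apply: (power_mean_gt0 m_gt0 r0 s0 rs (y0 a j) (y'0 a j)).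
  + rewrite /f /= !mulrBr addrACA -opprD; apply: lerB.
      rewrite !mulr_sumr -big_split /=; apply: ler_sum => j _.
      by rewrite (zP j).2 mulrDr !(mulrCA (d j)).
    rewrite !mulr_sumr -big_split /=; apply: ler_sum => a _.
    rewrite !(mulrCA _ (b a)) -mulrDr ler_wpM2l//.
    by apply: (prod_exp_concave (m := m)) => // j; have [] := wP a j.
  + move=> [a j]; rewrite /g /= (zP j).2 (wP a j).2 !mulrBr; lra.
- by split=> /=.
- by move=> [a j]; rewrite /g /= expr1n subr_lt0 exprn_egt1// ?ltr1n// -lt0n.
(* Feasible copies satisfy [y a j <= x j]; as [b a >= 0], replacing [x] by them only raises the
   objective. *)
- move=> [x y] [/= x0 y0] gxy; apply: le_trans (F0 x x0) _.
  rewrite /f /= lerB//; apply: ler_sum => a _; rewrite ler_wpM2l//.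
  apply: ler_prod => j _; have yaj := ltW (y0 a j); have xj := ltW (x0 j).
  have := gxy (a, j); rewrite mem_index_enum /g /= subr_le0 => /(_ isT).
  by rewrite ler_pXn2r// exprn_ge0//= => yx; rewrite lerXn2r.
exists (fun a j => la (a, j)) => // x y x0 y0.
have /= := fla (x, y) (conj x0 y0); rewrite /f /g /=.
have -> : \sum_i la i * (y i.1 i.2 ^+ m - x i.2 ^+ m) =
    \sum_a \sum_j la (a, j) * y a j ^+ m - \sum_j \sum_a la (a, j) * x j ^+ m.
  rewrite [X in _ = _ - X]exchange_big /= !pair_bigA -sumrB /=.
  by apply: eq_bigr => -[a j] _; rewrite mulrBr.
under [X in _ -> _ <= X + _]eq_bigr do rewrite mulrBl mulr_suml.
by rewrite !sumrB; lra.
Qed.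

(** In [nonneg_lagrange] each [x j] and each block [y a] varies independently and enters
    homogeneously of degree [m]. Letting one grow while the rest stay at [1] forces its own term to
    be nonnegative. *)
Lemma nonneg_split :
    (forall x : J -> R, (forall j, 0 < x j) ->
       0 <= \sum_j d j * x j ^+ m - \sum_a b a * \prod_j x j ^+ e a j) ->
  exists la : A -> J -> R, [/\ forall a j, 0 <= la a j,
    forall j, \sum_a la a j <= d j &
    forall a x, (forall j, 0 < x j) ->
      b a * \prod_j x j ^+ e a j <= \sum_j la a j * x j ^+ m].
Proof.
move=> /nonneg_lagrange[la la0 H]; exists la; split=> // [j|a x x0].
  rewrite -subr_ge0; apply: (affine_ge0_slope (v :=
    \sum_(i | i != j) (d i - \sum_a la a i) +
    \sum_a (\sum_j la a j * 1 ^+ m - b a * \prod_j 1 ^+ e a j))) => s s0.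
  have [t t0 ts] := exists_root_gt0 m_gt0 s0.
  have := H (fun i => if i == j then t else 1) (fun _ _ => 1).
  move=> /(_ _ _)/wrap[||]//; first by move=> i; case: ifP.
  rewrite (bigD1 j)//= eqxx ts addrA [s * _]mulrC.
  by under [X in _ <= _ + X + _ -> _]eq_bigr => i /negPf-> do rewrite expr1n mulr1.
rewrite -subr_ge0; apply: (affine_ge0_slope (v :=
    \sum_j (d j - \sum_a la a j) * 1 ^+ m +
    \sum_(a' | a' != a) (\sum_j la a' j * 1 ^+ m - b a' * \prod_j 1 ^+ e a' j))).
move=> s s0.
have [t t0 ts] := exists_root_gt0 m_gt0 s0.
have := H (fun=> 1) (fun a' j => if a' == a then t * x j else 1).
move=> /(_ _ _)/wrap[||]//.
  by move=> a' j; case: ifP => // _; rewrite mulr_gt0.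
rewrite (bigD1 a)//= eqxx addrCA.
under [X in _ <= X - _ + _ -> _]eq_bigr do rewrite exprMn ts mulrCA.
under [X in _ <= _ - _ * X + _ -> _]eq_bigr do rewrite exprMn.
rewrite -mulr_sumr big_split /= -expr_sum eE ts mulrCA -mulrBr.
by under [X in _ <= _ + (_ + X) -> _]eq_bigr => a' /negPf-> do [].
Qed.

End Split.

(** * Nonnegative binomials are sums of squares *)

Section BinomialSOS.
Variables (R : realType) (n : nat) (J : finType) (m : nat) (e : J -> nat).
Variables (la : J -> R) (b : R).
Hypotheses (m_gt0 : (0 < m)%N) (m_even : ~~ odd m) (em : (\sum_j e j)%N = m).
Hypotheses (la_ge0 : forall j, 0 <= la j) (b_gt0 : 0 < b).
Hypothesis nonneg : forall x : J -> R, (forall j, 0 < x j) ->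
  b * \prod_j x j ^+ e j <= \sum_j la j * x j ^+ m.

(** If [la j = 0], the right-hand side does not depend on [x j], while the monomial is unbounded in
    it. *)
Lemma nonneg_weight_gt0 j : (0 < e j)%N -> 0 < la j.
Proof.
move=> ej; rewrite lt_def la_ge0 andbT; apply/eqP => laj.
pose K := \sum_(i | i != j) la i.
have K0 : 0 <= K by rewrite sumr_ge0.
have Kb : 0 <= K / b by rewrite divr_ge0// ltW.
(* Then [b * s = K + b > K], and [s >= 1] gives [s ^+ e j >= s]. *)
pose s := K / b + 1.
have s1 : 1 <= s by rewrite lerDr.
have := nonneg (x := fun i => if i == j then s else 1).
have -> : \prod_i (if i == j then s else 1) ^+ e i = s ^+ e j.
  rewrite (bigD1 j)//= eqxx big1 ?mulr1// => i /negPf->.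
  by rewrite expr1n.
have -> : \sum_i la i * (if i == j then s else 1) ^+ m = K.
  rewrite (bigD1 j)//= laj mul0r add0r; apply: eq_bigr => i /negPf->.
  by rewrite expr1n mulr1.
move=> /(_ _)/wrap[i|]; first by case: ifP => // _; exact: lt_le_trans s1.
apply/negP; rewrite -ltNge; apply: lt_le_trans (_ : b * s <= _).
  by rewrite /s mulrDr mulrCA divff ?gt_eqF// !mulr1 ltrDl.
by rewrite ler_pM2l// ler_eXnr.
Qed.

(** Rescaling by [t] turns the weights with [e j > 0] into those of Hurwitz's form; the bound on the
    monomial's coefficient is [nonneg] at [t], with the variables absent from the monomial sent to
    [0]. *)
Lemma nonneg_scaling : exists t : J -> R, [/\ forall j, 0 < t j,
  forall j, (0 < e j)%N -> la j * t j ^+ m = (e j)%:R &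
  b * \prod_j t j ^+ e j <= m%:R].
Proof.
have /fin_all_exists[t tP] j : exists u : R,
    0 < u /\ ((0 < e j)%N -> la j * u ^+ m = (e j)%:R).
  case: (posnP (e j)) => [_|ej]; first by exists 1.
  have laj := nonneg_weight_gt0 ej.
  have [|u u0 um] := @exists_root_gt0 R m ((e j)%:R / la j) m_gt0.
    by rewrite divr_gt0// ltr0n.
  by exists u; split=> // _; rewrite um mulrCA divff ?mulr1// gt_eqF.
exists t; split=> [j|j|]; [exact: (tP j).1 | exact: (tP j).2 |].
(* Absent variables take the value [r] with [r ^+ m = s^-1]; multiplying the inequality by [s] makes
   it affine in [s]. *)
rewrite -subr_ge0; apply: (@affine_ge0_slope R _ (\sum_(j | e j == 0%N) la j)).
move=> s s0; have si0 : 0 < s^-1 by rewrite invr_gt0.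
have [r r0 rm] := exists_root_gt0 m_gt0 si0.
have := nonneg (x := fun j => if e j == 0%N then r else t j).
move=> /(_ _)/wrap[j|]; first by case: ifP => // _; exact: (tP j).1.
have -> : \prod_j (if e j == 0%N then r else t j) ^+ e j = \prod_j t j ^+ e j.
  by apply: eq_bigr => j _; case: eqP => // ->; rewrite !expr0.
have -> : \sum_j la j * (if e j == 0%N then r else t j) ^+ m =
    (\sum_(j | e j == 0%N) la j) / s + m%:R.
  rewrite (bigID (fun j => e j == 0%N)) /=; congr (_ + _).
    by rewrite mulr_suml; apply: eq_bigr => j ->; rewrite rm.
  rewrite -[in RHS]em natr_sum [RHS](bigID (fun j => e j == 0%N)) /=.
  rewrite [X in _ = X + _]big1 ?add0r; last by move=> j /eqP->.
  by apply: eq_bigr => j ej; rewrite (negPf ej) /= (tP j).2// lt0n.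
rewrite -subr_ge0 -addrA => h; have := mulr_ge0 (ltW s0) h.
rewrite mulrDr [s * (_ / s)]mulrCA divff ?gt_eqF// mulr1; lra.
Qed.

Lemma SOS_nonneg_binomial (y : J -> {mpoly R[n]}) :
  SOS (\sum_j la j *: y j ^+ m - b *: \prod_j y j ^+ e j).
Proof.
have [t [t0 tE tb]] := nonneg_scaling.
set tau := \prod_j t j ^+ e j in tb.
have tau0 : 0 < tau by apply: prodr_gt0 => j _; rewrite exprn_gt0.
have mR : 0 < m%:R :> R by rewrite ltr0n.
pose y' j := (t j)^-1 *: y j.
pose S1 := \sum_j (e j)%:R *: y' j ^+ m.
pose S2 := \sum_(j | e j == 0%N) la j *: y j ^+ m.
pose P := \prod_j y' j ^+ e j.
have -> : \sum_j la j *: y j ^+ m = S1 + S2.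
  rewrite /S1 (bigID (fun j => e j == 0%N)) /= addrC; congr (_ + _).
  rewrite [RHS](bigID (fun j => e j == 0%N)) /=.
  rewrite [X in _ = X + _]big1 ?add0r; last by move=> j /eqP->; rewrite scale0r.
  apply: eq_bigr => j ej; rewrite exprZn scalerA -tE ?lt0n//.
  by rewrite exprVn mulfK// expf_neq0// gt_eqF.
have -> : b *: \prod_j y j ^+ e j = (b * tau) *: P.
  have -> : \prod_j y j ^+ e j = tau *: P.
    rewrite /P /tau -scaler_prod; apply: eq_bigr => j _.
    by rewrite exprZn scalerA exprVn divff ?scale1r// expf_neq0// gt_eqF.
  by rewrite scalerA.
set c := b * tau in tb *.
have c0 : 0 <= c by rewrite ltW// mulr_gt0.
(* As [c <= m], a multiple of Hurwitz's form is split off and only even powers with nonnegative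
   weights remain. *)
have -> : S1 + S2 - c *: P =
    (c / m%:R) *: (S1 - m%:R *: P) + ((1 - c / m%:R) *: S1 + S2).
  rewrite scalerBr scalerA divfK ?gt_eqF// scalerBl scale1r.
  by rewrite [RHS]addrA [X in _ = X + _]addrC [X in _ = X + _]addrA subrK addrAC.
have S1S : SOS S1.
  by apply: SOS_sum => j _; apply: SOSZ => //; exact: SOS_even_exp.
apply: SOSD; first by apply: SOSZ; [rewrite divr_ge0// ltW | exact: SOS_hurwitz].
apply: SOSD.
  by apply: SOSZ => //; rewrite subr_ge0 ler_pdivrMr// mul1r.
by apply: SOS_sum => j _; apply: SOSZ => //; exact: SOS_even_exp.
Qed.

End BinomialSOS.

(* Index [ord0] stands for the homogenising variable, set to [1] in [hom_pt]. *)
Section Homogenization.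
Variables (n m : nat).

(** The homogenising variable takes the missing degree; the truncated subtraction is faithful only
    for [mdeg a <= m]. *)
Definition hom_exp (a : 'X_{1..n}) (j : 'I_n.+1) : nat :=
  if unlift ord0 j is Some i then a i else (m - mdeg a)%N.

Definition hom_pt (A : pzSemiRingType) (x : 'I_n -> A) (j : 'I_n.+1) : A :=
  if unlift ord0 j is Some i then x i else 1.

(** Pure powers and the constant form one family, the exponents exempt from the sign condition in
    degree [m]. *)
Definition diag_exp (j : 'I_n.+1) : 'X_{1..n} :=
  if unlift ord0 j is Some i then (U_(i) *+ m)%MM else 0%MM.

Lemma sum_hom_exp (a : 'X_{1..n}) : (mdeg a <= m)%N ->
  (\sum_j hom_exp a j)%N = m.
Proof.
move=> am; rewrite big_ord_recl /hom_exp unlift_none.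
under eq_bigr do rewrite liftK.
by rewrite -mdegE subnK.
Qed.

Lemma prod_hom_pt (A : comPzRingType) (x : 'I_n -> A) (a : 'X_{1..n}) :
  \prod_j hom_pt x j ^+ hom_exp a j = \prod_i x i ^+ a i.
Proof.
rewrite big_ord_recl /hom_pt /hom_exp unlift_none expr1n mul1r.
by apply: eq_bigr => i _; rewrite liftK.
Qed.

Lemma diag_exp_inj : (0 < m)%N -> injective diag_exp.
Proof.
move=> m0 j k /mnmP; rewrite /diag_exp.
case: unliftP => [i ->|->]; case: unliftP => [i' ->|->] //.
- move=> /(_ i); rewrite !mulmnE !mnm1E eqxx mul1n.
  by case: eqP => [->//|_]; rewrite mul0n => /eqP; rewrite (gtn_eqF m0).
- move=> /(_ i); rewrite mulmnE mnm1E mnm0E eqxx mul1n => /eqP.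
  by rewrite (gtn_eqF m0).
- move=> /(_ i'); rewrite mulmnE mnm1E mnm0E eqxx mul1n => /esym/eqP.
  by rewrite (gtn_eqF m0).
Qed.

End Homogenization.

(** * Polynomials with essentially nonpositive coefficients *)

Section EssNonpos.
Variables (R : realType) (n m : nat).
Hypotheses (m_gt0 : (0 < m)%N) (m_even : ~~ odd m).
Implicit Types f g h : {mpoly R[n]}.

(* Unlike [ess_nonpos], this refers to a fixed [m] instead of the degree of [f],
   which may drop when the Lagrangian is formed. *)
Definition ess_nonpos_le f : Prop := (msize f <= m.+1)%N /\
  forall a : 'X_{1..n}, (forall j, a != diag_exp m j) -> f@_a <= 0.

Lemma ess_nonpos_leP f : deg f = m -> ess_nonpos f -> ess_nonpos_le f.
Proof.
move=> fm fneg; split; first by rewrite -fm leqSpred.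
move=> a adiag; have [->//|fa] := eqVneq f@_a 0; apply: fneg.
split; last first.
  by move=> /= a0; have := adiag ord0; rewrite /diag_exp unlift_none a0 eqxx.
by split=> // i; rewrite fm; have := adiag (lift ord0 i); rewrite /diag_exp liftK.
Qed.

Lemma ess_nonpos_leD f g :
  ess_nonpos_le f -> ess_nonpos_le g -> ess_nonpos_le (f + g).
Proof.
move=> [fs fn] [gs gn]; split=> [|a ad].
  by rewrite (leq_trans (msizeD_le _ _))// geq_max fs.
by rewrite mcoeffD -[leRHS](addr0 0) lerD ?fn ?gn.
Qed.

Lemma ess_nonpos_leC (c : R) : ess_nonpos_le c%:MP.
Proof.
split=> [|a ad]; first by rewrite msizeC; case: eqP.
have := ad ord0; rewrite /diag_exp unlift_none mcoeffC eq_sym => /negPf.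
by rewrite eq_sym => ->; rewrite mulr0.
Qed.

Lemma ess_nonpos_leZ (c : R) f : 0 <= c ->
  ess_nonpos_le f -> ess_nonpos_le (c *: f).
Proof.
move=> c0 [fs fn]; split=> [|a ad]; first exact: leq_trans (msizeZ_le _ _) fs.
by rewrite mcoeffZ mulr_ge0_le0 ?fn.
Qed.

(** Subtracting the diagonal terms leaves only nonpositive coefficients; [b] is their negation, zero
    at diagonal exponents. *)
Lemma ess_nonpos_le_decomp f : ess_nonpos_le f ->
  exists (d : 'I_n.+1 -> R) (b : 'X_{1..n < m.+1} -> R), (forall a, 0 <= b a) /\
    f = \sum_j d j *: hom_pt (fun i => 'X_i) j ^+ m -
        \sum_a b a *: \prod_j hom_pt (fun i => 'X_i) j ^+ hom_exp m a j.
Proof.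
move=> [fs fn]; pose d j := f@_(diag_exp m j).
have diagE j : hom_pt (fun i => 'X_i) j ^+ m = 'X_[diag_exp m j] :> {mpoly R[n]}.
  rewrite /hom_pt /diag_exp; case: unliftP => [i _|_]; last first.
    by rewrite expr1n mpolyX0.
  by rewrite mpolyXn.
pose g := f - \sum_j d j *: 'X_[diag_exp m j].
have gE a : g@_a = f@_a - \sum_j d j * (diag_exp m j == a)%:R.
  rewrite /g mcoeffB; rewrite [X in _ - X]raddf_sum /=; congr (_ - _).
  by apply: eq_bigr => j _; rewrite mcoeffZ mcoeffX.
have g_le0 a : g@_a <= 0.
  rewrite gE; have [/existsP[j /eqP ja]|/existsPn ad] :=
      boolP [exists j, diag_exp m j == a].
    rewrite (bigD1 j)//= ja eqxx mulr1 /d ja big1 ?addr0 ?subrr// => i ij.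
    by rewrite -ja (inj_eq (diag_exp_inj m_gt0)) (negPf ij) mulr0.
  rewrite big1 ?subr0; last by move=> j _; rewrite (negPf (ad j)) mulr0.
  by apply: fn => j; rewrite eq_sym.
have mdeg_diag j : (mdeg (diag_exp m j) <= m)%N.
  rewrite /diag_exp; case: unliftP => [i _|_]; last by rewrite mdeg0.
  by rewrite mdegMn mdeg1 mul1n.
have gs : (msize g <= m.+1)%N.
  rewrite (leq_trans (msizeD_le _ _))// geq_max fs msizeN.
  apply: leq_trans (msize_sum _ _ _) _; apply/bigmax_leqP => j _.
  by apply: leq_trans (msizeZ_le _ _) _; rewrite msizeX ltnS.
exists d, (fun a => - g@_a); split=> [a|]; first by rewrite oppr_ge0.
under eq_bigr do rewrite diagE.
under [X in _ - X]eq_bigr => a _ do rewrite prod_hom_pt -mpolyXE_id scaleNr.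
by rewrite sumrN opprK -(mpolywE gs) /g addrC subrK.
Qed.

Lemma meval_decomp (d : 'I_n.+1 -> R) (b : 'X_{1..n < m.+1} -> R) (v : 'I_n -> R) :
  (\sum_j d j *: hom_pt (fun i => 'X_i) j ^+ m -
   \sum_a b a *: \prod_j hom_pt (fun i => 'X_i) j ^+ hom_exp m a j).@[v] =
  \sum_j d j * hom_pt v j ^+ m -
  \sum_a b a * \prod_j hom_pt v j ^+ hom_exp m a j.
Proof.
have ptE j : (hom_pt (fun i => 'X_i : {mpoly R[n]}) j).@[v] = hom_pt v j.
  by rewrite /hom_pt; case: unliftP => [i _|_]; rewrite ?mevalXU ?meval1.
rewrite mevalB; congr (_ - _); rewrite rmorph_sum /=; apply: eq_bigr => i _.
  by rewrite linearZ rmorphXn /= ptE.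
rewrite linearZ rmorph_prod /=; congr (_ * _); apply: eq_bigr => j _.
by rewrite rmorphXn /= ptE.
Qed.

(** The power mean [z] depends only on the points and weights, so it serves all [f] at once, as
    [slater_duality] requires. *)
Lemma ess_nonpos_le_convexlike (x y : 'I_n -> R) (a b : R) :
  0 <= a -> 0 <= b -> a + b = 1 -> exists z : 'I_n -> R,
    forall f, ess_nonpos_le f -> f.@[z] <= a * f.@[x] + b * f.@[y].
Proof.
move=> a0 b0 ab; have [z zP] := power_mean_exists m_gt0 m_even x y a0 b0.
(* The homogenising coordinate [1] is its own mean because [a + b = 1]. *)
have hzP j : 0 <= hom_pt z j /\
    hom_pt z j ^+ m = a * hom_pt x j ^+ m + b * hom_pt y j ^+ m.
  by rewrite /hom_pt; case: unliftP => [i _|_]; rewrite ?expr1n ?mulr1 ?ab.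
exists z => f /ess_nonpos_le_decomp[d [c [c0 ->]]]; rewrite !meval_decomp.
rewrite !mulrBr addrACA -opprD; apply: lerB.
  rewrite !mulr_sumr -big_split /=; apply: ler_sum => j _.
  by rewrite (hzP j).2 mulrDr !(mulrCA (d j)).
rewrite !mulr_sumr -big_split /=; apply: ler_sum => k _.
rewrite !(mulrCA _ (c k)) -mulrDr ler_wpM2l//.
apply: (prod_exp_concave (m := m)) => //; try by move=> j; have [] := hzP j.
by rewrite sum_hom_exp// -ltnS bmdeg.
Qed.

Lemma nonneg_ess_nonpos_SOS f :
  ess_nonpos_le f -> (forall x, 0 <= f.@[x]) -> SOS f.
Proof.
move=> /ess_nonpos_le_decomp[d [b [b0 ->]]] f0.
have eE (a : 'X_{1..n < m.+1}) : (\sum_j hom_exp m a j)%N = m.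
  by rewrite sum_hom_exp// -ltnS bmdeg.
have [|la [la0 lad lab]] := nonneg_split (d := d) m_gt0 m_even eE b0.
  (* Dehomogenisation: the form at [x] is [x ord0 ^+ m] times the polynomial at [v]. *)
  move=> x x0; pose v i := x (lift ord0 i) / x ord0.
  have xE j : x j = x ord0 * hom_pt v j.
    rewrite /hom_pt; case: unliftP => [i ->|->]; last by rewrite mulr1.
    by rewrite /v mulrC divfK// gt_eqF.
  have := f0 v; rewrite meval_decomp => /(mulr_ge0 (exprn_ge0 m (ltW (x0 ord0)))).
  rewrite mulrBr !mulr_sumr.
  congr (_ <= _ - _); apply: eq_bigr => i _.
    by rewrite mulrCA -exprMn -xE.
  rewrite mulrCA; congr (_ * _).
  rewrite -[X in _ ^+ X * _](eE i) -prodrXr -big_split /=; apply: eq_bigr => j _.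
  by rewrite -exprMn -xE.
set y := hom_pt _.
have -> : \sum_j d j *: y j ^+ m - \sum_a b a *: \prod_j y j ^+ hom_exp m a j =
    \sum_j (d j - \sum_a la a j) *: y j ^+ m +
    \sum_a (\sum_j la a j *: y j ^+ m - b a *: \prod_j y j ^+ hom_exp m a j).
  under [X in _ = X + _]eq_bigr do rewrite scalerBl scaler_suml.
  by rewrite !sumrB exchange_big /= addrA subrK.
apply: SOSD.
  by apply: SOS_sum => j _; apply: SOSZ; [rewrite subr_ge0 | exact: SOS_even_exp].
apply: SOS_sum => a _; have := b0 a; rewrite le_eqVlt => /predU1P[<-|ba].
  rewrite scale0r subr0; apply: SOS_sum => j _.
  by apply: SOSZ => //; exact: SOS_even_exp.
exact: (SOS_nonneg_binomial m_gt0 m_even (eE a) (la0 a) ba (lab a)).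
Qed.

End EssNonpos.

(** * Weak and strong duality for the optimization problem *)

Section Duality.
Variables (R : realType) (n p m : nat) (f : 'I_p.+1 -> {mpoly R[n]}).

Lemma weak_duality (mu : R) : sos_feasible m f mu -> (mu%:E <= minP f)%E.
Proof.
move=> [la [sigma [sigmaE la0 Ssigma _]]].
apply: le_ereal_inf_tmp => _ [x fx <-]; rewrite lee_fin.
have := SOS_meval_ge0 x Ssigma; rewrite -sigmaE mevalB mevalD mevalC.
rewrite rmorph_sum /= => h.
have : \sum_(l < p) (la l *: f (lift ord0 l)).@[x] <= 0.
  by apply: sumr_le0 => l _; rewrite mevalZ mulr_ge0_le0//; exact: fx.
by move: h; lra.
Qed.

Hypotheses (m_gt0 : (0 < m)%N) (m_even : ~~ odd m).
Hypotheses (f_en : forall l, ess_nonpos_le m (f l)).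
Hypothesis slater : strictly_feasible f.

(** Multipliers for the objective [f ord0 - mu] make the Lagrangian [h] nonnegative; [h] stays in
    the cone [ess_nonpos_le], so it is SOS. *)
Lemma strong_duality (mu : R) :
  (forall x, feasible f x -> mu <= (f ord0).@[x]) -> sos_feasible m f mu.
Proof.
move=> mu_le; have [x0 fx0] := slater.
have [||la la0 Lge0] := @slater_duality R _ _ (index_enum 'I_p)
    (fun x => (f ord0).@[x] - mu) (fun l x => (f (lift ord0 l)).@[x])
    (fun=> True) x0 (index_enum_uniq _) _ I fx0.
- move=> x y a b _ _ a0 b0 ab.
  have [z zP] := ess_nonpos_le_convexlike m_gt0 m_even x y a0 b0 ab.
  exists z; split=> // [|l]; last exact: zP.
  have -> : a * ((f ord0).@[x] - mu) + b * ((f ord0).@[y] - mu) =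
      a * (f ord0).@[x] + b * (f ord0).@[y] - mu.
    by rewrite -[in RHS](mul1r mu) -ab; ring.
  by rewrite lerD2r zP.
- move=> x _ fx; rewrite subr_ge0; apply: mu_le => l.
  by apply: fx; rewrite mem_index_enum.
pose h := f ord0 + \sum_(l < p) la l *: f (lift ord0 l) - mu%:MP.
have h_en : ess_nonpos_le m h.
  rewrite /h -mpolyCN; apply: ess_nonpos_leD (ess_nonpos_leC _ _ _).
  apply: ess_nonpos_leD => //; apply: big_ind => [||l _].
  - by rewrite -mpolyC0; exact: ess_nonpos_leC.
  - exact: ess_nonpos_leD.
  - exact: ess_nonpos_leZ.
exists la, h; split=> //.
- apply: (nonneg_ess_nonpos_SOS m_gt0) => // x.
  rewrite /h mevalB mevalD mevalC rmorph_sum /= addrAC.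
  by under eq_bigr do rewrite mevalZ; exact: Lge0.
- by rewrite /deg; case: (msize h) h_en.1.
Qed.

End Duality.

Theorem theorem4p2 (R : realType) (n p m : nat)
    (hn : (0 < n)%N) (hp : (0 < p)%N) (hm : (0 < m)%N) (hm2 : ~~ odd m)
    (f : 'I_p.+1 -> {mpoly R[n]})
    (hf : forall l, ess_nonpos (f l))
    (hdeg : forall l, deg (f l) = m)
    (hstrict : strictly_feasible f) :
  minP f = ereal_sup [set mu%:E | mu in sos_feasible m f] /\
  (minP f != -oo%E ->
   exists2 mu : R, sos_feasible m f mu & minP f = mu%:E).
Proof.
have f_en l : ess_nonpos_le m (f l) by exact: ess_nonpos_leP.
have sup_le : (ereal_sup [set mu%:E | mu in sos_feasible m f] <= minP f)%E.
  by apply: ge_ereal_sup => _ [mu muf <-]; exact: weak_duality muf.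
have attained : minP f != -oo%E ->
    exists2 mu : R, sos_feasible m f mu & minP f = mu%:E.
  have minP_le x : feasible f x -> (minP f <= (f ord0).@[x]%:E)%E.
    by move=> fx; apply: ereal_inf_lbound; exists x.
  (* The Slater point is feasible, which excludes the value [+oo]. *)
  have [x0 fx0] := hstrict; have := minP_le x0 (fun l => ltW (fx0 l)).
  case E : (minP f) => [mu| |] // _ _; exists mu => //.
  apply: strong_duality => // x /minP_le.
  by rewrite E lee_fin.
split=> //; apply/eqP; rewrite eq_le sup_le andbT.
have [->|/attained[mu muf ->]] := eqVneq (minP f) -oo%E; first by rewrite leNye.
by apply: ereal_sup_ubound; exists mu.
Qed.
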